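(* For any $\Psi\in L^2(-1,1)$ such that $$(1-z^2)^{1/2}\Psi_z\in L^2(-1,1),\quad(1-z^2)^{3/2}\Psi_{zz}\in L^2(-1,1),$$ we have $$Q_0[\Psi]+M_0[\Psi]^2\ge\frac{3}{56}\left(J_0[\Psi]+M_0[\Psi]^2\right),$$ where $$M_0[\Psi]:=\int_{-1}^1\Psi\,dz,\qquad J_0[\Psi]:=\int_{-1}^1(1-z^2)\Psi_z^2\,dz,$$ $$Q_0[\Psi]:=\frac18\int_{-1}^1(1-z^2)^3\Psi_{zz}^2\,dz+\frac34\int_{-1}^1(3z^2-1)\Psi^2\,dz .$$
   Context: Functions are real-valued, and the derivatives $\Psi_z,\Psi_{zz}$ are in the sense of distributions on $(-1,1)$. *)

(* Defs.v *)
From HB Require Import structures.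
From mathcomp Require Import all_boot all_order all_algebra.
From mathcomp Require Import all_classical all_reals all_analysis.

Set Implicit Arguments.
Unset Strict Implicit.
Unset Printing Implicit Defensive.

Import Order.TTheory GRing.Theory Num.Theory.
Import numFieldNormedType.Exports.

Local Open Scope classical_set_scope.
Local Open Scope ring_scope.

Definition Iopen (R : realType) : set R := `]-1, 1[.

(* Membership in L^2(-1,1) for a representative f : R -> R.  The values of f
   outside (-1,1) are irrelevant: Lfun bundles measurability with finiteness of
   the norm over the whole line, so f is first extended by 0 off (-1,1). *)
Definition in_L2 (R : realType) (f : R -> R) : Prop :=
  (f \_ (@Iopen R)) \in Lfun (@lebesgue_measure R) 2%:E.

(* phi belongs to C_c^oo(-1,1). *)
Definition test_function (R : realType) (phi : R -> R) : Prop :=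
  let supp := closure [set x | phi x != 0] in
  [/\ forall (n : nat) (x : R), derivable (derive1n n phi) x 1,
      compact supp & supp `<=` @Iopen R].

(* The n-th distributional derivative of f on (-1,1) is (the regular
   distribution given by) the locally integrable function g.
   No generality is lost by taking distributional derivatives to be functions
   here: the derivatives of interest are assumed to lie in L^2(-1,1) after
   multiplication by a smooth positive weight on (-1,1), and dividing by this
   weight shows that such a distribution is a locally integrable function. *)
Definition distr_derive (R : realType) (n : nat) (f g : R -> R) : Prop :=
  [/\ locally_integrable (@Iopen R) f,
      locally_integrable (@Iopen R) g &
      forall phi : R -> R, test_function phi ->
        \int[lebesgue_measure]_(z in @Iopen R) (g z * phi z) =
        (-1) ^+ n *
          \int[lebesgue_measure]_(z in @Iopen R) (f z * derive1n n phi z)].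

(* In the functionals below, f stands for Psi, and f1, f2 for its first and
   second distributional derivatives. *)
Definition M0 (R : realType) (f : R -> R) : R :=
  \int[lebesgue_measure]_(z in @Iopen R) f z.

Definition J0 (R : realType) (f1 : R -> R) : R :=
  \int[lebesgue_measure]_(z in @Iopen R) ((1 - z ^+ 2) * f1 z ^+ 2).

Definition Q0 (R : realType) (f f2 : R -> R) : R :=
  1 / 8 * \int[lebesgue_measure]_(z in @Iopen R)
            ((1 - z ^+ 2) ^+ 3 * f2 z ^+ 2) +
  3 / 4 * \int[lebesgue_measure]_(z in @Iopen R)
            ((3 * z ^+ 2 - 1) * f z ^+ 2).

(* Main.v *)
Require Import Defs.
From HB Require Import structures.
From mathcomp Require Import all_boot all_order all_algebra.
From mathcomp Require Import all_classical all_reals all_analysis.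
From mathcomp Require Import measurable_realfun lra ring.

(* Write w = 1 - z^2.  The distributional derivatives are functions, so Psi has a
   C^1 representative F whose derivative U is absolutely continuous with
   derivative p = Psi_zz; products of such functions can be integrated by parts
   on compact subintervals.  Let m = M0/2 and let G be the primitive of F - m
   vanishing at -1; it also vanishes at 1.  Up to derivatives of functions that
   are quadratic in (U, F, G, m),
     (1/8) w^3 p^2 = (1/8) w (w p - 2 z U + 3 F)^2 + (1/2) w U^2
                     - (3/8) (1 + 3 z^2) F^2,
     w U^2 = w (U + 2 G)^2 + 4 w (F - m)^2 + 4 z^2 G^2,
     m w (F - m) = 2 m z G.
   Inserting the first two in Q0 - (3/56) J0, using the third for one third of
   the cross term in m w (F - m), and completing the squares leaves
   -(195/74 + 63/100) m^2, and 195/74 + 63/100 < 53/14 = 4 (1 - 3/56).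
   The boundary terms tend to 0 along suitable sequences: F^2 + w U^2 is integrable
   on (-1,1) and 1/w is not, so w F^2 + w^2 U^2 is small at points arbitrarily
   close to the endpoints. *)

Import Order.TTheory GRing.Theory Num.Theory.
Import numFieldNormedType.Exports.

Local Open Scope classical_set_scope.
Local Open Scope ring_scope.

Set Implicit Arguments.
Unset Strict Implicit.
Unset Printing Implicit Defensive.

(** * Locally absolutely continuous functions on (-1,1) and integration by parts *)

Section primitive.
Context {R : realType}.
Notation mu := (@lebesgue_measure R).
Implicit Types (f g F G : R -> R) (a b : R).

(** Local absolute continuity of [F] with derivative [f], stated through the fundamental theorem of
    calculus, so that no pointwise derivative of [F] has to exist. *)
Definition primitive f F := forall a b, -1 < a -> a <= b -> b < 1 ->
  mu.-integrable `[a, b] (EFin \o f) /\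
  F b - F a = \int[mu]_(x in `[a, b]) f x.

Lemma primitive_continuous f F a b : primitive f F -> -1 < a -> a <= b -> b < 1 ->
  {within `[a, b], continuous F}.
Proof.
move=> fF a1 ab b1; have [intf _] := fF a b a1 ab b1.
have cI := parameterized_integral_continuous ab intf.
apply: (@subspace_eq_continuous _ _ _ (fun x => F a + parameterized_integral mu a x f)).
  move=> x; rewrite inE/= in_itv/= => /andP[ax xb].
  have [_ E] := fF a x a1 ax (le_lt_trans xb b1).
  by rewrite /from_subspace /parameterized_integral -E addrC subrK.
by move=> x; apply: cvgD; [exact: cvg_cst|exact: cI].
Qed.

Lemma within_continuous_measurable F a b : {within `[a, b], continuous F} ->
  measurable_fun `[a, b] F.
Proof. by move=> cF; apply: subspace_continuous_measurable_fun. Qed.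

Lemma within_continuous_bounded F a b : {within `[a, b], continuous F} ->
  [bounded F x | x in `[a, b]].
Proof.
move=> cF; have /compact_bounded[M [_ HM]] := continuous_compact cF (@segment_compact R a b).
by exists M; split; rewrite ?num_real // => ? ? ? ?; exact: HM.
Qed.

Lemma integrable_continuous_mul f G a b : mu.-integrable `[a, b] (EFin \o f) ->
  {within `[a, b], continuous G} ->
  mu.-integrable `[a, b] (EFin \o (fun x => f x * G x)).
Proof.
move=> intf cG.
have mI : measurable `[a, b]%classic by [].
have := (@integrableMl _ _ _ mu _ mI (EFin \o f) G intf
  (within_continuous_measurable cG) (within_continuous_bounded cG)).
by apply: eq_integrable.
Qed.

Lemma primitiveD f g F G : primitive f F -> primitive g G ->
  primitive (fun x => f x + g x) (fun x => F x + G x).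
Proof.
move=> fF gG a b a1 ab b1.
have [intf Ef] := fF a b a1 ab b1; have [intg Eg] := gG a b a1 ab b1; split.
  exact: (integrableD _ intf intg).
by rewrite RintegralD// -Ef -Eg; ring.
Qed.

Lemma primitiveZ k f F : primitive f F ->
  primitive (fun x => k * f x) (fun x => k * F x).
Proof.
move=> fF a b a1 ab b1; have [intf Ef] := fF a b a1 ab b1; split.
  exact: (integrableZl _ k intf).
by rewrite RintegralZl// -Ef mulrBr.
Qed.

Lemma eq_primitive f g F G : f =1 g -> F =1 G -> primitive f F -> primitive g G.
Proof. by move=> /funext -> /funext ->. Qed.

(** Fubini for f(x) g(y) on the triangle a <= y <= x <= b: integrating in y first gives the left
    side, integrating in x first gives the right side. *)
Lemma primitive_ibp f g F G a b : primitive f F -> primitive g G ->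
  -1 < a -> a <= b -> b < 1 ->
  \int[mu]_(x in `[a, b]) (f x * (G x - G a)) =
  \int[mu]_(x in `[a, b]) (g x * (F b - F x)).
Proof.
move=> fF gG a1 ab b1.
have [intf _] := fF a b a1 ab b1; have [intg _] := gG a b a1 ab b1.
pose f' := f \_ `[a, b]; pose g' := g \_ `[a, b].
have intf' : mu.-integrable setT (EFin \o f').
  by rewrite -restrict_EFin; apply/(integrable_mkcond _ _).1.
have intg' : mu.-integrable setT (EFin \o g').
  by rewrite -restrict_EFin; apply/(integrable_mkcond _ _).1.
have mf' : measurable_fun setT f' by apply/measurable_EFinP; case/integrableP: intf'.
have mg' : measurable_fun setT g' by apply/measurable_EFinP; case/integrableP: intg'.
pose K0 (z : R * R) : \bar R := (f' z.1 * g' z.2)%:E.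
have mK0 : measurable_fun setT K0.
  apply/measurable_EFinP; apply: measurable_funM.
  - exact: (measurableT_comp mf' measurable_fst).
  - exact: (measurableT_comp mg' measurable_snd).
(* By Tonelli, the integral of |f'(x) g'(y)| over the plane is the product of the two L^1 norms. *)
have intK0 : (mu \x mu)%E.-integrable setT K0.
  apply/(integrable12ltyP mu mu mK0) => /=.
  have E x : (\int[mu]_y `|K0 (x, y)| = `|f' x|%:E * \int[mu]_y `|g' y|%:E)%E.
    rewrite -ge0_integralZl_EFin//; last exact/measurable_EFinP/measurableT_comp.
    by apply: eq_integral => y _; rewrite /K0/= normrM EFinM.
  under eq_integral do rewrite E.
  rewrite ge0_integralZr//; last 2 first.
  - exact/measurable_EFinP/measurableT_comp.
  - exact: integral_ge0.
  case/integrableP: intf' => _ lf; case/integrableP: intg' => _ lg.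
  apply: lte_mul_pinfty => //; first exact: integral_ge0.
  by rewrite ge0_fin_numE//; exact: integral_ge0.
(* The kernel restricted to the triangle stays integrable, being dominated by [K0]. *)
pose K (z : R * R) : \bar R := if z.2 <= z.1 then K0 z else 0%E.
have mK : measurable_fun setT K.
  apply: measurable_fun_ifT => //.
  by apply: measurable_fun_ler; [exact: measurable_snd|exact: measurable_fst].
have intK : (mu \x mu)%E.-integrable setT K.
  apply: le_integrable intK0 => // z _; rewrite /K.
  by case: ifP => //; rewrite abse0.
have E1 x : (\int[mu]_y K (x, y) = (((fun x => f x * (G x - G a)) \_ `[a, b]) x)%:E)%E.
  rewrite patchE; case: ifPn => [|xab]; last first.
    by rewrite integral0_eq// => y _; rewrite /K /K0 /f' /= patchE (negbTE xab) mul0r; case: ifP.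
  rewrite inE/= in_itv/= => /andP[ax xb].
  have [intx ->] := gG a x a1 ax (le_lt_trans xb b1).
  rewrite -RintegralZl// /Rintegral fineK; last first.
    by apply: integrable_fin_num => //; exact: (integrableZl _ (f x) intx).
  rewrite [RHS]integral_mkcond; apply: eq_integral => y _.
  rewrite /K /K0 /f' /g' /= !patchE !mem_setE !in_itv/= ax xb /=.
  case: (leP a y) => ay /=; last by rewrite mulr0; case: ifP.
  case: (leP y x) => yx //=.
  by rewrite (le_trans yx xb).
have E2 y : (\int[mu]_x K (x, y) = (((fun x => g x * (F b - F x)) \_ `[a, b]) y)%:E)%E.
  rewrite patchE; case: ifPn => [|yab]; last first.
    by rewrite integral0_eq// => x _; rewrite /K /K0 /g' /= patchE (negbTE yab) mulr0; case: ifP.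
  rewrite inE/= in_itv/= => /andP[ay yb].
  have [inty ->] := fF y b (lt_le_trans a1 ay) yb b1.
  rewrite -RintegralZl// /Rintegral fineK; last first.
    by apply: integrable_fin_num => //; exact: (integrableZl _ (g y) inty).
  rewrite [RHS]integral_mkcond; apply: eq_integral => x _.
  rewrite /K /K0 /f' /g' /= !patchE !mem_setE !in_itv/= ay yb /=.
  case: (leP x b) => xb; rewrite ?andbF ?andbT /=; last by rewrite mul0r; case: ifP.
  case: (leP y x) => yx //=.
  by rewrite (le_trans ay yx) mulrC.
have := Fubini intK.
under eq_integral do rewrite E1.
under [X in _ = X -> _]eq_integral do rewrite E2.
by move=> E; rewrite Rintegral_mkcond [RHS]Rintegral_mkcond /Rintegral E.
Qed.

(** Expanding both sides of [primitive_ibp] gives the integral of f G + g F as F(b) G(b) - F(a)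
    G(a). *)
Lemma primitiveM f g F G : primitive f F -> primitive g G ->
  primitive (fun x => f x * G x + g x * F x) (fun x => F x * G x).
Proof.
move=> fF gG a b a1 ab b1.
have [intf Ef] := fF a b a1 ab b1; have [intg Eg] := gG a b a1 ab b1.
have intfG : mu.-integrable `[a, b] (EFin \o (fun x => f x * G x)).
  exact/integrable_continuous_mul/(primitive_continuous gG).
have intgF : mu.-integrable `[a, b] (EFin \o (fun x => g x * F x)).
  exact/integrable_continuous_mul/(primitive_continuous fF).
split; first exact: (integrableD _ intfG intgF).
rewrite RintegralD//.
have := primitive_ibp fF gG a1 ab b1.
under eq_Rintegral do rewrite mulrBr.
under [RHS]eq_Rintegral do rewrite mulrBr.
have intfa : mu.-integrable `[a, b] (EFin \o (fun x => f x * G a)).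
  exact: (integrableZr _ (G a) intf).
have intgb : mu.-integrable `[a, b] (EFin \o (fun x => g x * F b)).
  exact: (integrableZr _ (F b) intg).
by rewrite !RintegralB// ?RintegralZr// -?Ef -?Eg; lra.
Qed.

Lemma primitive_derive f F : (forall x : R, is_derive x 1 F (f x)) -> continuous f ->
  primitive f F.
Proof.
move=> dF cf a b a1 ab b1.
have cf' : {within `[a, b], continuous f} by exact: continuous_subspaceT.
have intf : mu.-integrable `[a, b] (EFin \o f).
  by apply: continuous_compact_integrable => //; exact: segment_compact.
split=> //; move: ab; rewrite le_eqVlt => /predU1P[->|ab].
  by rewrite subrr set_itv1 Rintegral_set1.
rewrite /Rintegral (@continuous_FTC2 _ f F)//.
  split; first by move=> x _; have := dF x; case.
  - apply: cvg_at_right_filter; apply: differentiable_continuous.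
    by apply/derivable1_diffP; case: (dF a).
  - apply: cvg_at_left_filter; apply: differentiable_continuous.
    by apply/derivable1_diffP; case: (dF b).
by move=> x _; rewrite derive1E; case: (dF x).
Qed.

End primitive.

(** * Smooth functions built from exp(-1/x) *)

Section smooth.
Context {R : realType}.
Implicit Types (f g F G phi : R -> R) (x d : R).

Lemma is_derive_cvg f x d :
  (t^-1 * (f (t + x) - f x)) @[t --> 0^'] --> d -> is_derive x 1 f d.
Proof.
move=> fd.
have E : (fun h : R => h^-1 *: ((f \o shift x) (h *: 1) - f x)) =
         (fun t => t^-1 * (f (t + x) - f x)).
  by apply/funext => t; rewrite /= [t *: _]mulr1.
apply: DeriveDef; first by rewrite /derivable E; apply/cvg_ex; exists d.
by rewrite /derive E; apply/cvg_lim => //; exact: Rhausdorff.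
Qed.

Lemma is_derive_quotient f x d : is_derive x 1 f d ->
  (t^-1 * (f (t + x) - f x)) @[t --> 0^'] --> d.
Proof.
move=> [fd <-].
have E : (fun h : R => h^-1 *: ((f \o shift x) (h *: 1) - f x)) =
         (fun t => t^-1 * (f (t + x) - f x)).
  by apply/funext => t; rewrite /= [t *: _]mulr1.
by move: fd; rewrite /derivable /derive E.
Qed.

Lemma near_is_derive f g x d : (\forall y \near x, f y = g y) ->
  is_derive x 1 f d -> is_derive x 1 g d.
Proof.
move=> fg /is_derive_quotient fd; apply: is_derive_cvg.
apply: cvg_trans fd; apply: near_eq_cvg.
have fgx : f x = g x by exact: nbhs_singleton fg.
have : \forall t \near (0:R)^', f (t + x) = g (t + x).
  by apply: nbhs_dnbhs; move: fg; rewrite (near_shift 0 x) subr0.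
by move=> H; near=> t; rewrite fgx (near H t).
Unshelve. all: end_near. Qed.

Definition smooth phi := forall (n : nat) x, derivable (derive1n n phi) x 1.

(** By induction on the order, every iterated derivative stays in the class [P], hence is
    differentiable; no formula for higher derivatives is required. *)
Lemma smooth_stable (P : (R -> R) -> Prop) :
  (forall f, P f -> exists2 g, P g & forall x, is_derive x 1 f (g x)) ->
  forall f, P f -> smooth f.
Proof.
move=> HP f Pf n; have : P (derive1n n f).
  elim: n => [//|n IH]; rewrite /derive1n iterS -/(derive1n n f).
  have [g Pg dg] := HP _ IH.
  suff -> : derive1 (derive1n n f) = g by [].
  by apply/funext => x; rewrite derive1E; have [] := dg x.
by move=> /HP[g _ dg] x; have [] := dg x.
Qed.

Lemma smooth_primitive phi f : smooth f -> (forall x, is_derive x 1 phi (f x)) ->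
  smooth phi.
Proof.
move=> sf dphi [|n] x; first by have [] := dphi x.
have E : derive1 phi = f.
  by apply/funext => y; rewrite derive1E; have [] := dphi y.
by rewrite /derive1n iterSr E; exact: sf.
Qed.

Lemma smooth_continuous phi : smooth phi -> continuous phi.
Proof.
move=> sphi x; apply: differentiable_continuous; apply/derivable1_diffP.
exact: (sphi 0%N).
Qed.

Lemma smooth_is_derive phi x : smooth phi -> is_derive x 1 phi (derive1 phi x).
Proof. by move=> sphi; rewrite derive1E; apply: derivableP; exact: (sphi 0%N). Qed.

Lemma smooth_derive1 phi : smooth phi -> smooth (derive1 phi).
Proof. by move=> sphi n x; have := sphi n.+1 x; rewrite /derive1n iterSr. Qed.

(* The factor x^-k makes the span of the family closed under derivation. *)
Definition flat (k : nat) x := if 0 < x then x ^- k * expR (- x^-1) else 0.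

Lemma flat_ge0 k x : 0 <= flat k x.
Proof.
by rewrite /flat; case: ifP => // x0; rewrite mulr_ge0 ?expR_ge0// invr_ge0 exprn_ge0// ltW.
Qed.

Lemma flat_le k x : flat k x <= (k.+2)`!%:R * x ^+ 2.
Proof.
rewrite /flat; case: ifPn => [x0|_]; last by rewrite mulr_ge0 ?sqr_ge0.
have := @expR_ge1Dxn _ x^-1 k.+1 _; rewrite invr_ge0 => /(_ (ltW x0)) H.
have H' : x^-1 ^+ k.+2 / (k.+2)`!%:R <= expR x^-1 by apply: le_trans H; rewrite lerDr.
have fgt : 0 < (k.+2)`!%:R :> R by rewrite ltr0n fact_gt0.
move: H'; rewrite ler_pdivrMr// => H'.
rewrite expRN ler_pdivrMr ?expR_gt0//.
have -> : x ^- k = x ^+ 2 * x^-1 ^+ k.+2.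
  by rewrite -[k.+2]addn2 exprD mulrCA -exprMn divff ?gt_eqF// expr1n mulr1 exprVn.
by rewrite [leRHS]mulrAC mulrC ler_wpM2r ?sqr_ge0// mulrC.
Qed.

Lemma is_derive_flat k x : is_derive x 1 (flat k) (flat k.+2 x - k%:R * flat k.+1 x).
Proof.
have [x0|x0|->] := ltgtP x 0.
- have -> : flat k.+2 x - k%:R * flat k.+1 x = 0.
    by rewrite /flat !(lt_gtF x0) mulr0 subr0.
  apply: (@near_is_derive (cst 0)).
    near=> y; rewrite /flat ifF//; apply/negbTE; rewrite -leNgt.
    by near: y; move: (lt_nbhsl x0); apply: filterS => y /ltW.
- apply: (@near_is_derive (fun y => y ^- k * expR (- y^-1))).
    near=> y; rewrite /flat ifT//.
    by near: y; exact: lt_nbhsr.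
  have xn : x != 0 by rewrite gt_eqF.
  have d0 n : is_derive x 1 (fun y : R => y ^+ n) (n%:R * x ^+ n.-1).
    have H := @is_deriveX _ _ id n x 1 1 (is_derive_id x 1).
    rewrite exprfctE in H; apply: (is_derive_eq H).
    by rewrite /GRing.scale/= mulr1.
  have d1 : is_derive x 1 (fun y : R => y ^- k) (- (x ^+ k) ^- 2 *: (k%:R * x ^+ k.-1)).
    by apply: is_deriveV => //; rewrite expf_neq0.
  have d2 : is_derive x 1 (fun y : R => y^-1) (- x ^- 2 *: 1).
    exact: is_deriveV.
  have d2' : is_derive x 1 (fun y : R => - y^-1) (x ^- 2).
    have H := is_deriveN d2; apply: (is_derive_eq H).
    by rewrite /GRing.scale/= mulr1 opprK.
  have d3 : is_derive x 1 (fun y : R => expR (- y^-1)) (expR (- x^-1) * x ^- 2).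
    exact: (@is_derive1_comp _ expR (fun y => - y^-1) _ _ _ (is_derive_expR _) d2').
  have H := is_deriveM d1 d3; apply: (is_derive_eq H).
  rewrite /flat x0 /GRing.scale/=; case: k {d1 H} => [|k].
    by rewrite !expr0 invr1; field.
  rewrite /= (exprS x k.+2) (exprS x k.+1) (exprS x k); set E := expR _.
  have xk : x ^+ k != 0 by rewrite expf_neq0.
  set z := x ^+ k in xk *. field.
  by rewrite xn xk.
(* At 0 the difference quotient is at most (k+2)! |t| in absolute value, by [flat_le]. *)
- rewrite /flat ltxx mulr0 subr0 -/(flat k).
  apply: is_derive_cvg; apply/cvgrPdist_lt => e e0.
  have fgt : 0 < (k.+2)`!%:R :> R by rewrite ltr0n fact_gt0.
  near=> t.
  have t0 : t != 0 by near: t; exact: nbhs_dnbhs_neq.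
  rewrite addr0 {2}/flat ltxx subr0 sub0r normrN normrM normfV.
  rewrite ltr_pdivrMl ?normr_gt0// (ger0_norm (flat_ge0 _ _)).
  apply: le_lt_trans (flat_le _ _) _.
  rewrite -real_normK ?num_real// expr2 mulrA mulrC ltr_pM2l ?normr_gt0//.
  rewrite mulrC -ltr_pdivlMr//; near: t; apply: dnbhs0_lt; exact: divr_gt0.
Unshelve. all: end_near. Qed.

(** A class containing the bumps and closed under derivation, to which [smooth_stable] applies. *)
Inductive flat_alg : (R -> R) -> Prop :=
| flat_alg0 c : flat_alg (cst c)
| flat_alg_comp k s c : flat_alg (fun x => flat k (s * x + c))
| flat_algD f g : flat_alg f -> flat_alg g -> flat_alg (fun x => f x + g x)
| flat_algM f g : flat_alg f -> flat_alg g -> flat_alg (fun x => f x * g x).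

Lemma flat_alg_smooth f : flat_alg f -> smooth f.
Proof.
move: f; apply: smooth_stable => f.
elim => {f}[c|k s c|f g _ [f' Pf' df] _ [g' Pg' dg]|f g Pf [f' Pf' df] Pg [g' Pg' dg]].
- exists (cst 0); first exact: flat_alg0.
  by move=> x; exact: is_derive_cst.
- exists (fun x => s * (flat k.+2 (s * x + c) + (- k%:R) * flat k.+1 (s * x + c))).
    apply: (flat_algM (flat_alg0 s)); apply: flat_algD; first exact: flat_alg_comp.
    by apply: (flat_algM (flat_alg0 _)); exact: flat_alg_comp.
  move=> x.
  have d1 : is_derive x 1 (fun y => s * y + c) s.
    have H := is_deriveD (is_deriveZ s (is_derive_id x 1)) (is_derive_cst c x 1).
    by apply: (is_derive_eq H); rewrite addr0 /GRing.scale/= mulr1.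
  have d2 := is_derive_flat k (s * x + c).
  have H := @is_derive1_comp _ (flat k) (fun y => s * y + c) _ _ _ d2 d1.
  by apply: (is_derive_eq H); ring.
- exists (fun x => f' x + g' x); first exact: flat_algD.
  by move=> x; exact: is_deriveD.
- exists (fun x => f x * g' x + g x * f' x).
    by apply: flat_algD; exact: flat_algM.
  by move=> x; exact: is_deriveM.
Qed.
End smooth.

(** * Test functions, bumps and the du Bois-Reymond lemma *)

Section weak_derivative.
Context {R : realType}.
Notation mu := (@lebesgue_measure R).
Notation I := (@Iopen R).
Implicit Types (f g h F G phi : R -> R) (x a b r : R).

(** Keeping an explicit radius r < 1 turns integrals over (-1,1) into integrals over [-r, r], where
    [primitive] and [loc_integrable] apply. *)
Definition supported r phi := forall x, r <= `|x| -> phi x = 0.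

Lemma smooth_test_function phi r : r < 1 -> smooth phi -> supported r phi ->
  test_function phi.
Proof.
move=> r1 sphi supp.
have sub : closure [set x | phi x != 0] `<=` `[- r, r].
  rewrite closureE; apply: smallest_sub => [|x /=].
    exact: (@interval_closed _ (BLeft (- r)) (BRight r)).
  apply: contra_neqP => /negP; rewrite in_itv/= -ler_norml -ltNge => /ltW.
  exact: supp.
split=> //.
  apply: (subclosed_compact _ (@segment_compact _ (- r) r) sub).
  exact: closed_closure.
move=> x /sub /=; rewrite /Iopen /= !in_itv/= => /andP[rx xr].
by rewrite (lt_le_trans _ rx) ?(le_lt_trans xr)// ltrN2.
Qed.

Definition loc_integrable f := forall a b, -1 < a -> a <= b -> b < 1 ->
  mu.-integrable `[a, b] (EFin \o f).

Lemma locally_integrable_itv f : locally_integrable I f -> loc_integrable f.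
Proof.
move=> [mf _ If] a b a1 ab b1.
have sub : `[a, b] `<=` I.
  move=> x; rewrite /Iopen /= !in_itv/= => /andP[ax xb].
  by rewrite (lt_le_trans a1 ax) (le_lt_trans xb b1).
apply/integrableP; split; last by apply: (If _ sub); exact: segment_compact.
by apply/measurable_EFinP; apply: measurable_funS mf => //; exact: measurable_itv.
Qed.

Lemma sub_supp r : 0 <= r -> r < 1 -> `[- r, r] `<=` I.
Proof.
move=> r0 r1 x; rewrite /Iopen /= !in_itv/= => /andP[ax xb].
by rewrite (lt_le_trans _ ax) ?(le_lt_trans xb r1)// ltrN2.
Qed.

Lemma supported_patch r f : 0 <= r -> r < 1 -> supported r f ->
  {in I, f =1 f \_ `[- r, r]}.
Proof.
move=> r0 r1 supp x _; rewrite patchE; case: ifPn => // /negP.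
rewrite inE/= in_itv/= -ler_norml => /negP; rewrite -ltNge => /ltW; exact: supp.
Qed.

Lemma supported_integrable r f : 0 <= r -> r < 1 -> supported r f ->
  mu.-integrable `[- r, r] (EFin \o f) -> mu.-integrable I (EFin \o f).
Proof.
move=> r0 r1 supp intf.
have mI : measurable I by exact: measurable_itv.
have : mu.-integrable I ((EFin \o f) \_ `[- r, r]).
  by apply/integrable_restrict => //; rewrite setIidr//; exact: sub_supp.
apply: eq_integrable => // x xI; rewrite restrict_EFin /=.
by rewrite -(supported_patch r0 r1 supp xI).
Qed.

Lemma supported_Rintegral r f : 0 <= r -> r < 1 -> supported r f ->
  \int[mu]_(x in I) f x = \int[mu]_(x in `[- r, r]) f x.
Proof.
move=> r0 r1 supp; rewrite (eq_Rintegral mu (supported_patch r0 r1 supp)).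
by rewrite -Rintegral_mkcondr setIidr//; exact: sub_supp.
Qed.

Lemma supported_mul_integrable r h phi : 0 <= r -> r < 1 -> loc_integrable h ->
  supported r phi -> continuous phi -> mu.-integrable I (EFin \o (fun x => h x * phi x)).
Proof.
move=> r0 r1 lh supp cphi; apply: (supported_integrable r0 r1).
  by move=> x /supp ->; rewrite mulr0.
apply: integrable_continuous_mul; last exact: continuous_subspaceT.
by apply: lh => //; [rewrite ltrN2|rewrite ge0_cp].
Qed.

(* As n grows the profile exp(-1/(n t)) tends to 1 for t > 0, so bump a b n
   tends to the indicator of ]a, b[ while staying in [0, 1]. *)
Definition bump a b (n : nat) x : R :=
  flat 0 (n.+1%:R * x + - (n.+1%:R * a)) * flat 0 (- n.+1%:R * x + n.+1%:R * b).

Lemma bump_smooth a b n : smooth (bump a b n).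
Proof. by apply: flat_alg_smooth; apply: flat_algM; exact: flat_alg_comp. Qed.

Lemma flat0_le1 x : flat 0 x <= 1 :> R.
Proof.
rewrite /flat; case: ifPn => // x0; rewrite expr0 invr1 mul1r.
by rewrite expR_le1 oppr_le0 invr_ge0 ltW.
Qed.

Lemma bump_norm_le1 a b n x : `|bump a b n x| <= 1.
Proof.
rewrite ger0_norm; last by rewrite mulr_ge0 ?flat_ge0.
by rewrite mulr_ile1 ?flat_ge0 ?flat0_le1.
Qed.

Lemma bump_out a b n x : x \notin `]a, b[ -> bump a b n x = 0.
Proof.
rewrite in_itv/= negb_and -!leNgt /bump /flat => /orP[xa|bx].
  by rewrite ifN ?mul0r// -leNgt -mulrBr mulr_ge0_le0// subr_le0.
rewrite [X in _ * X]ifN ?mulr0// -leNgt mulNr addrC -mulrBr mulr_ge0_le0//.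
by rewrite subr_le0.
Qed.

Lemma bump_cvg a b x : x \in `]a, b[ -> bump a b n x @[n --> \oo] --> (1 : R).
Proof.
rewrite in_itv/= => /andP[ax xb].
have cv y : 0 < y -> flat 0 (n.+1%:R * y) @[n --> \oo] --> (1 : R).
  move=> y0.
  have -> : (fun n : nat => flat 0 (n.+1%:R * y) : R) =
            (fun n => expR (- (y^-1 * harmonic n))).
    apply/funext => n; rewrite /flat mulr_gt0// expr0 invr1 mul1r invfM.
    by rewrite mulrC.
  have -> : 1 = expR (- (y^-1 * 0)) :> R by rewrite mulr0 oppr0 expR0.
  apply: continuous_cvg; first exact: continuous_expR.
  by apply: cvgN; apply: cvgM; [exact: cvg_cst|exact: cvg_harmonic].
rewrite -[X in _ --> X]mulr1 /bump; apply: cvgM.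
  by under eq_fun do rewrite -mulrBr; apply: cv; rewrite subr_gt0.
by under eq_fun do rewrite mulNr addrC -mulrBr; apply: cv; rewrite subr_gt0.
Qed.

Lemma bump_supported a b n : -1 < a -> a < b -> b < 1 ->
  exists r, [/\ 0 <= r, r < 1 & supported r (bump a b n)].
Proof.
move=> a1 ab b1; exists (Num.max `|a| `|b|); split.
- by rewrite le_max normr_ge0.
- by rewrite gt_max !ltr_norml a1 b1 (lt_trans ab b1) (lt_trans a1 ab).
move=> x; rewrite ge_max => /andP[xa xb]; apply: bump_out.
rewrite in_itv/=; apply/negP => /andP[ax xb'].
have [x0|x0] := leP 0 x.
  by move: xb; rewrite (ger0_norm x0) leNgt (lt_le_trans xb' (ler_norm b)).
move: xa; rewrite (ltr0_norm x0) leNgt -normrN (lt_le_trans _ (ler_norm (- a)))//.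
by rewrite ltrN2.
Qed.

(** Dominated convergence on ]a, b[ with dominating function |h|, since the bumps take values in
    [0, 1] and vanish off ]a, b[. *)
Lemma bump_cvg_integral h a b : loc_integrable h -> -1 < a -> a < b -> b < 1 ->
  \int[mu]_(x in I) (h x * bump a b n x) @[n --> \oo] --> \int[mu]_(x in `[a, b]) h x.
Proof.
move=> lh a1 ab b1.
have sub : `]a, b[ `<=` `[a, b] by exact: subset_itv_oo_cc.
have lhab : mu.-integrable `]a, b[ (EFin \o h).
  by apply: integrableS (lh _ _ a1 (ltW ab) b1).
have E n : \int[mu]_(x in I) (h x * bump a b n x) =
           fine (\int[mu]_(x in `]a, b[) (h x * bump a b n x)%:E).
  have H : {in I, (fun x => h x * bump a b n x) =1 (fun x => h x * bump a b n x) \_ `]a, b[}.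
    move=> x _; rewrite patchE; case: ifPn => // /negP xab.
    by rewrite bump_out ?mulr0//; apply/negP => xab'; apply: xab; rewrite inE.
  rewrite (eq_Rintegral mu H) -Rintegral_mkcondr setIidr//.
  by apply: subset_itv => //; rewrite bnd_simp ltW.
under eq_fun do rewrite E.
have -> : \int[mu]_(x in `[a, b]) h x = \int[mu]_(x in `]a, b[) h x.
  rewrite Rintegral_itv_bndo_bndc// Rintegral_itv_obnd_cbnd//.
  by apply: integrableS (lh _ _ a1 (ltW ab) b1) => //; exact: subset_itv_oc_cc.
apply: fine_cvg; rewrite fineK; last exact: integrable_fin_num.
have mh : measurable_fun `]a, b[ h by apply/measurable_EFinP; case/integrableP: lhab.
have := @dominated_convergence _ _ _ mu `]a, b[%classic _
  (fun n x => (h x * bump a b n x)%:E) (EFin \o h) (fun x => `|h x|%:E).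
case=> //.
- move=> n; apply/measurable_EFinP/measurable_funM => //.
  apply: measurable_funTS; apply: continuous_measurable_fun.
  exact/smooth_continuous/bump_smooth.
- exact/measurable_EFinP.
- apply: aeW => x xab; apply: cvg_EFin; first exact: nearW.
  by rewrite -[X in _ --> X]mulr1; apply: cvgM; [exact: cvg_cst|exact: bump_cvg].
- exact: integrable_norm.
- apply: aeW => x n _; rewrite lee_fin normrM ler_piMr//; exact: bump_norm_le1.
Qed.

(* The combination of bumps has zero integral, so its primitive has compact support. *)
Lemma bump_primitive a b a' b' n : -1 < a -> a < b -> b < 1 ->
  -1 < a' -> a' < b' -> b' < 1 ->
  exists phi r, [/\ 0 <= r, r < 1, supported r phi, smooth phi &
    derive1 phi = (fun x => (\int[mu]_(y in I) bump a' b' n y) * bump a b n x -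
                            (\int[mu]_(y in I) bump a b n y) * bump a' b' n x)].
Proof.
move=> a1 ab b1 a'1 ab' b'1.
have [r [r0 r1 supp]] := bump_supported n a1 ab b1.
have [r' [r'0 r'1 supp']] := bump_supported n a'1 ab' b'1.
set A := \int[mu]_(y in I) bump a b n y; set A' := \int[mu]_(y in I) bump a' b' n y.
pose chi x := A' * bump a b n x - A * bump a' b' n x.
pose s := Num.max r r'.
have s0 : 0 <= s by rewrite le_max r0.
have s1 : s < 1 by rewrite gt_max r1.
have suppc : supported s chi.
  by move=> x; rewrite ge_max /chi => /andP[/supp -> /supp' ->]; rewrite !mulr0; exact: subr0.
have schi : smooth chi.
  have -> : chi = (fun x => A' * bump a b n x + (- A) * bump a' b' n x).
    by apply/funext => x; rewrite /chi mulNr.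
  apply: flat_alg_smooth; apply: flat_algD; apply: (flat_algM (flat_alg0 _));
  by apply: flat_algM; exact: flat_alg_comp.
have cchi := smooth_continuous schi.
have intc u v : mu.-integrable `[u, v] (EFin \o chi).
  apply: continuous_compact_integrable; first exact: segment_compact.
  exact: continuous_subspaceT.
have int1 c d n' : -1 < c -> c < d -> d < 1 -> mu.-integrable I (EFin \o bump c d n').
  move=> c1 cd d1; have [q [q0 q1 suppq]] := bump_supported n' c1 cd d1.
  apply: (supported_integrable q0 q1 suppq).
  apply: continuous_compact_integrable; first exact: segment_compact.
  exact/continuous_subspaceT/smooth_continuous/bump_smooth.
have mI : measurable I by exact: measurable_itv.
have chi0 : \int[mu]_(x in I) chi x = 0.
  rewrite /chi RintegralB; [|exact: measurable_itv| |].
  - rewrite (RintegralZl A' _ (int1 _ _ n a1 ab b1)); last exact: measurable_itv.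
    rewrite (RintegralZl A _ (int1 _ _ n a'1 ab' b'1)); last exact: measurable_itv.
    rewrite mulrC; exact: subrr.
  - exact: (integrableZl _ A' (int1 _ _ _ a1 ab b1)).
  - exact: (integrableZl _ A (int1 _ _ _ a'1 ab' b'1)).
pose phi x := \int[mu]_(t in `[-1, x]) chi t.
have phi_left x : x <= - s -> phi x = 0.
  move=> xs; rewrite /phi (@eq_Rintegral _ _ _ mu _ (cst 0)).
    by rewrite Rintegral_cst// mul0r.
  move=> t; rewrite inE/= in_itv/= => /andP[_ tx]; apply: suppc.
  have ts : t <= - s by exact: le_trans tx xs.
  by rewrite lerNr in ts; rewrite -normrN (le_trans ts (ler_norm _)).
(* To the right of s the integral covers the whole support of [chi], and [chi] has total integral
   0. *)
have phi_right x : s <= x -> phi x = 0.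
  move=> sx; rewrite /phi.
  have H : {in `[-1, x]%classic, chi =1 chi \_ `[- s, s]}.
    move=> t _; rewrite patchE; case: ifPn => // /negP.
    rewrite inE/= in_itv/= -ler_norml => /negP; rewrite -ltNge => /ltW; exact: suppc.
  rewrite (eq_Rintegral mu H) -Rintegral_mkcondr setIidr.
    by rewrite -(supported_Rintegral s0 s1 suppc) chi0.
  by apply: subset_itv; rewrite bnd_simp// lerNl opprK ltW.
have dphi x : is_derive x 1 phi (chi x).
  (* For x <= -1 < -s the function [phi] vanishes near x; beyond -1 the fundamental theorem applies
     to the integral starting at -1. *)
  have [x1|x1] := leP x (-1).
    rewrite suppc; last by rewrite ler0_norm; lra.
    apply: (@near_is_derive _ (cst 0)) => //.
    have xs : x < - s by lra.
    by have := lt_nbhsl xs; apply: filterS => y /ltW ys; rewrite phi_left.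
  have xx : x < x + 1 by rewrite ltrDl.
  have [dx Ex] := continuous_FTC1_closed xx (intc _ _) x1 (cchi x).
  by apply: DeriveDef; [exact: dx|rewrite -derive1E; exact: Ex].
exists phi, s; split; [exact: s0|exact: s1| | |].
- by move=> x; rewrite ler_normr => /orP[/phi_right//|sx]; apply: phi_left; rewrite lerNr.
- exact: smooth_primitive schi dphi.
- by apply/funext => x; rewrite derive1E; case: (dphi x).
Qed.

(** Testing against the primitive of a zero-mean combination of bumps on ]a, b[ and ]a', b'[ shows
    that the integrals of h against the two bumps are proportional to the integrals of the bumps. In
    the limit the integrals of h over the two intervals are proportional to their lengths. *)
Lemma du_bois_reymond h : loc_integrable h ->
  (forall phi r, 0 <= r -> r < 1 -> supported r phi -> smooth phi ->
     \int[mu]_(x in I) (h x * derive1 phi x) = 0) ->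
  exists c, forall a b, -1 < a -> a < b -> b < 1 ->
    \int[mu]_(x in `[a, b]) h x = c * (b - a).
Proof.
move=> lh Hh.
(* The reference interval has length 1, so the constant is the integral of h over it. *)
pose a' : R := - 2^-1; pose b' : R := 2^-1.
have a'1 : -1 < a' by rewrite /a'; lra.
have ab' : a' < b' by rewrite /a' /b'; lra.
have b'1 : b' < 1 by rewrite /b'; lra.
exists (\int[mu]_(x in `[a', b']) h x) => a b a1 ab b1.
have mI : measurable I by exact: measurable_itv.
have hb c d n : -1 < c -> c < d -> d < 1 ->
    mu.-integrable I (EFin \o (fun x => h x * bump c d n x)).
  move=> c1 cd d1; have [q [q0 q1 suppq]] := bump_supported n c1 cd d1.
  by apply: (supported_mul_integrable q0 q1 lh suppq); exact/smooth_continuous/bump_smooth.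
have hbZ k c d n : -1 < c -> c < d -> d < 1 ->
    \int[mu]_(x in I) (k * (h x * bump c d n x)) = k * \int[mu]_(x in I) (h x * bump c d n x).
  by move=> c1 cd d1; apply: (RintegralZl k _ (hb _ _ n c1 cd d1)).
have E n :
   (\int[mu]_(x in I) (h x * bump a b n x)) * (\int[mu]_(x in I) (1 * bump a' b' n x)) =
   (\int[mu]_(x in I) (h x * bump a' b' n x)) * (\int[mu]_(x in I) (1 * bump a b n x)).
  have [phi [r [r0 r1 supp sphi dphi]]] := bump_primitive n a1 ab b1 a'1 ab' b'1.
  have := Hh phi r r0 r1 supp sphi; rewrite dphi.
  set A := \int[mu]_(y in I) bump a b n y; set A' := \int[mu]_(y in I) bump a' b' n y.
  rewrite (eq_Rintegral mu (g := fun x => A' * (h x * bump a b n x) -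
     A * (h x * bump a' b' n x))); last by move=> x _; ring.
  rewrite RintegralB; [|exact: measurable_itv| |].
  - rewrite (hbZ _ _ _ _ a1 ab b1) (hbZ _ _ _ _ a'1 ab' b'1) => /subr0_eq H.
    have E1 c d : \int[mu]_(x in I) (1 * bump c d n x) = \int[mu]_(x in I) bump c d n x.
      by apply: eq_Rintegral => x _; rewrite mul1r.
    rewrite !E1 [LHS]mulrC [RHS]mulrC; exact: H.
  - exact: (integrableZl _ _ (hb _ _ n a1 ab b1)).
  - exact: (integrableZl _ _ (hb _ _ n a'1 ab' b'1)).
(* Taking h = 1 in [bump_cvg_integral] gives the limits of the bump integrals, namely the interval
   lengths. *)
have l1 : loc_integrable (cst 1).
  move=> c d _ _ _; apply: continuous_compact_integrable; first exact: segment_compact.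
  by apply: continuous_subspaceT => x; exact: cvg_cst.
have C1 c d : c < d -> \int[mu]_(x in `[c, d]) (cst 1 x : R) = d - c.
  move=> cd; rewrite Rintegral_cst// mul1r.
  by have := lebesgue_measure_itv (`[c, d]%R); rewrite /= lte_fin cd => ->.
have L := cvgM (bump_cvg_integral lh a1 ab b1) (bump_cvg_integral l1 a'1 ab' b'1).
have L' := cvgM (bump_cvg_integral lh a'1 ab' b'1) (bump_cvg_integral l1 a1 ab b1).
move: L L'; rewrite !C1//.
have -> : b' - a' = 1 by rewrite /b' /a'; lra.
have FF : Filter (\oo : set_system nat) by exact: filter_filter.
rewrite mulr1 => /(_ FF) L /(_ FF) L'.
pose u n := \int[mu]_(x in I) (h x * bump a b n x) * \int[mu]_(x in I) (1 * bump a' b' n x).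
pose v n := \int[mu]_(x in I) (h x * bump a' b' n x) * \int[mu]_(x in I) (1 * bump a b n x).
have Lu : u @ \oo --> \int[mu]_(x in `[a, b]) h x by exact: L.
have Lv : v @ \oo --> \int[mu]_(x in `[a', b']) h x * (b - a) by exact: L'.
have uv : u = v by apply/funext => n; exact: E.
rewrite uv in Lu.
have Eu := cvg_lim (@Rhausdorff R) Lu; have Ev := cvg_lim (@Rhausdorff R) Lv.
exact: etrans (esym (Eu _)) (Ev _).
Qed.

End weak_derivative.

(** * Functions with a weak derivative agree almost everywhere with a primitive of it *)

Section weak_primitive.
Context {R : realType}.
Notation mu := (@lebesgue_measure R).
Notation I := (@Iopen R).
Implicit Types (f g h F G phi : R -> R) (x a b r : R).

Lemma Rintegral_itv_split f a b c : a <= b -> b <= c ->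
  mu.-integrable `[a, c] (EFin \o f) ->
  \int[mu]_(x in `[a, c]) f x = \int[mu]_(x in `[a, b]) f x + \int[mu]_(x in `[b, c]) f x.
Proof.
move=> ab bc intf.
have := @Rintegral_itvB _ f (BLeft a) (BRight c) b intf ab bc.
rewrite Rintegral_itv_obnd_cbnd; first by move=> <-; rewrite addrC subrK.
apply: integrableS intf => //.
by apply: subset_itv; rewrite bnd_simp.
Qed.

Lemma Rintegral_itv_ge f a b : b <= a -> \int[mu]_(x in `[a, b]) f x = 0.
Proof.
rewrite le_eqVlt => /predU1P[->|ba]; first by rewrite set_itv1 Rintegral_set1.
by rewrite set_itv_ge ?Rintegral_set0// bnd_simp -ltNge.
Qed.

Lemma loc_integrable_primitive g : loc_integrable g -> exists G, primitive g G.
Proof.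
move=> lg.
(* One of the two intervals is empty or reduced to a point. *)
exists (fun x => \int[mu]_(t in `[0, x]) g t - \int[mu]_(t in `[x, 0]) g t).
move=> a b a1 ab b1; split; first exact: lg.
have [a0|a0] := leP 0 a.
  have b0 := le_trans a0 ab.
  rewrite (Rintegral_itv_ge _ a0) (Rintegral_itv_ge _ b0) !subr0.
  rewrite (Rintegral_itv_split a0 ab); last by apply: lg => //; lra.
  by rewrite addrC addKr.
have [b0|b0] := leP b 0.
  rewrite (Rintegral_itv_ge _ (ltW a0)) (Rintegral_itv_ge _ b0) !sub0r.
  rewrite (Rintegral_itv_split ab b0); last by apply: lg => //; lra.
  by rewrite opprK addrC addrK.
rewrite (Rintegral_itv_ge _ (ltW a0)) (Rintegral_itv_ge _ (ltW b0)) subr0 sub0r opprK.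
by rewrite (Rintegral_itv_split (ltW a0) (ltW b0)) 1?addrC//; exact: lg.
Qed.

(** Lebesgue differentiation: on each [-q, q] with q < 1 the cumulative integral of h is identically
    0, so its almost everywhere derivative h vanishes. Countably many q exhaust (-1,1). *)
Lemma ae_eq0_Rintegral_itv h : loc_integrable h ->
  (forall a b, -1 < a -> a < b -> b < 1 -> \int[mu]_(x in `[a, b]) h x = 0) ->
  {ae mu, forall x, I x -> h x = 0}.
Proof.
move=> lh h0.
(* The shift by 2 makes every [q n] positive, starting from 1/2. *)
pose q n : R := 1 - n.+2%:R^-1.
have q1 n : q n < 1 by rewrite /q gtrBl invr_gt0.
have q0 n : 0 < q n by rewrite /q subr_gt0 invf_lt1// ltr1n.
have qN n : -1 < - q n by rewrite ltrN2.
have qq n : - q n < q n by rewrite gtrN.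
suff H n : {ae mu, forall x, `]- q n, q n[%classic x -> h x = 0}.
  have := ae_foralln H; apply: filterS => x Hx.
  rewrite /Iopen /= in_itv/= -ltr_norml => x1.
  have x1' : 0 < 1 - `|x| by rewrite subr_gt0.
  have [n _ /(_ n (leqnn n)) /= Hn] := near_infty_natSinv_lt (PosNum x1').
  apply: (Hx n); rewrite /= in_itv/= -ltr_norml /q ltrBrDr -ltrBrDl.
  by apply: le_lt_trans Hn; rewrite lef_pV2 ?posrE// ler_nat.
have lhn := lh _ _ (qN n) (ltW (qq n)) (q1 n).
pose k := h \_ `[- q n, q n].
have intk : mu.-integrable setT (EFin \o k).
  by rewrite -restrict_EFin; apply/(integrable_mkcond _ _).1.
have intkS (D : set R) : measurable D -> mu.-integrable D (EFin \o k).
  by move=> mD; apply: integrableS intk.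
have lk : locally_integrable setT k.
  by apply: open_integrable_locally => //; exact: openT.
have := @FTC1 _ k (BLeft (- q n)) (fun y => intkS _ (measurable_itv _)) lk.
set F := (fun x : R => _).
have F0 : F = cst 0.
  apply/funext => x; rewrite /F /k -Rintegral_mkcondr.
  have [xq|qx] := leP x (- q n).
    rewrite setIidl; first exact: Rintegral_itv_ge.
    by apply: subset_itv; rewrite bnd_simp// (le_trans xq) ?ltW.
  have [xq|qx'] := leP x (q n).
    rewrite setIidl; first by apply: h0 => //; exact: le_lt_trans xq (q1 n).
    by apply: subset_itv; rewrite bnd_simp.
  rewrite setIidr; first exact: h0.
  by apply: subset_itv; rewrite bnd_simp// ltW.
apply: filterS; first exact: (ae_filter_ringOfSetsType mu).
move=> x /= Hx; rewrite in_itv/= => /andP[x1 x2].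
have [_] := Hx x1.
rewrite F0 derive1_cst /k patchE mem_set//=.
by rewrite in_itv/= !ltW.
Qed.

(** Enlarging the radius ensures that [phi] vanishes on a whole neighbourhood of each x with r' <=
    |x|. *)
Lemma supported_derive1 r r' phi : r < r' -> supported r phi -> smooth phi ->
  supported r' (derive1 phi).
Proof.
move=> rr' supp sphi x rx.
suff : is_derive x 1 phi 0 by rewrite derive1E; case.
apply: (@near_is_derive _ (cst 0)) => //.
have : r < `|x| by exact: lt_le_trans rx.
have [x0|x0] := leP 0 x.
  rewrite ger0_norm// => {}rx; have := lt_nbhsr rx; apply: filterS => y ry.
  by rewrite supp// ltW// (lt_le_trans ry)// ler_norm.
rewrite ltr0_norm// ltrNr => {}rx; have := lt_nbhsl rx; apply: filterS => y ry.
by rewrite supp// ltW// -normrN (lt_le_trans _ (ler_norm _))// ltrNr.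
Qed.

(** If G is any primitive of g, then f - G has zero weak derivative. By [du_bois_reymond] its
    integrals are those of a constant c, so f = G + c almost everywhere. *)
Lemma weak_primitive f g : loc_integrable f -> loc_integrable g ->
  (forall phi r, 0 <= r -> r < 1 -> supported r phi -> smooth phi ->
     \int[mu]_(x in I) (g x * phi x) = - \int[mu]_(x in I) (f x * derive1 phi x)) ->
  exists2 F, primitive g F & {ae mu, forall x, I x -> f x = F x}.
Proof.
move=> lf lg fg.
have [G gG] := loc_integrable_primitive lg.
have lG : loc_integrable G.
  move=> a b a1 ab b1; apply: continuous_compact_integrable; first exact: segment_compact.
  exact: primitive_continuous gG a1 ab b1.
have lfG : loc_integrable (fun x => f x - G x).
  by move=> a b a1 ab b1; apply: (integrableB _ (lf _ _ a1 ab b1) (lG _ _ a1 ab b1)).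
have [c Hc] : exists c, forall a b, -1 < a -> a < b -> b < 1 ->
    \int[mu]_(x in `[a, b]) (f x - G x) = c * (b - a).
  apply: du_bois_reymond => // phi r r0 r1 supp sphi.
  pose s := (r + 1) / 2.
  have rs : r < s by rewrite /s; lra.
  have s1 : s < 1 by rewrite /s; lra.
  have s0 : 0 <= s by exact: le_trans r0 (ltW rs).
  have supp' := supported_derive1 rs supp sphi.
  have supps : supported s phi by move=> x sx; apply: supp; exact: le_trans (ltW rs) sx.
  have sphi' := smooth_derive1 sphi.
  have cphi' := smooth_continuous sphi'.
  have sN : -1 < - s by rewrite ltrN2.
  have ss : - s <= s by rewrite ge0_cp.
  (* Integration by parts on [-s, s]; the boundary terms vanish because [phi] is 0 at both ends. *)
  have EG : \int[mu]_(x in I) (G x * derive1 phi x) = - \int[mu]_(x in I) (g x * phi x).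
    rewrite (supported_Rintegral s0 s1); last by move=> x /supp' ->; rewrite mulr0.
    rewrite (supported_Rintegral s0 s1); last by move=> x /supps ->; rewrite mulr0.
    have pphi : primitive (derive1 phi) phi.
      by apply: primitive_derive => // x; exact: smooth_is_derive.
    have [_] := primitiveM gG pphi sN ss s1.
    rewrite !supps ?normrN ?(ger0_norm s0)// !mulr0 subrr RintegralD//.
    - move/esym/eqP; rewrite addrC addr_eq0 => /eqP <-.
      by apply: eq_Rintegral => x _; exact: mulrC.
    - apply: integrable_continuous_mul; first exact: lg.
      exact/continuous_subspaceT/smooth_continuous.
    - apply: integrable_continuous_mul; last exact: primitive_continuous gG _ _ _.
      by case: (pphi _ _ sN ss s1).
  under eq_Rintegral do rewrite mulrBl.
  rewrite RintegralB; [|exact: measurable_itv| |].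
  - by rewrite EG (fg phi r r0 r1 supp sphi) opprK subrr.
  - exact: (supported_mul_integrable s0 s1 lf supp' cphi').
  - exact: (supported_mul_integrable s0 s1 lG supp' cphi').
exists (fun x => G x + c).
  move=> a b a1 ab b1; have [intg E] := gG _ _ a1 ab b1; split => //.
  by rewrite -E; ring.
have lc : loc_integrable (cst c).
  move=> a b _ _ _; apply: continuous_compact_integrable; first exact: segment_compact.
  by apply: continuous_subspaceT => x; exact: cvg_cst.
have lfGc : loc_integrable (fun x => f x - G x - c).
  by move=> a b a1 ab b1; apply: (integrableB _ (lfG _ _ a1 ab b1) (lc _ _ a1 ab b1)).
have := ae_eq0_Rintegral_itv lfGc _.
move=> H; apply: filterS (H _); first exact: (ae_filter_ringOfSetsType mu).
  by move=> x /[apply] /eqP; rewrite subr_eq0 subr_eq addrC => /eqP.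
move=> a b a1 ab b1; rewrite RintegralB; [|exact: measurable_itv| |].
- rewrite (Hc _ _ a1 ab b1) Rintegral_cst//.
  have := lebesgue_measure_itv (`[a, b]%R); rewrite /= lte_fin ab => ->.
  exact: subrr.
- exact: lfG a1 (ltW ab) b1.
- exact: lc a1 (ltW ab) b1.
Qed.

End weak_primitive.

(** * Limits at the endpoints and points where a weighted integrable function is small *)

Section endpoints.
Context {R : realType}.
Notation mu := (@lebesgue_measure R).
Notation I := (@Iopen R).
Implicit Types (f g h p q F G U : R -> R) (x a b e m : R).

Lemma sub_itv_I a b : -1 < a -> b < 1 -> `[a, b] `<=` I.
Proof. by move=> a1 b1; apply: subset_itv; rewrite bnd_simp. Qed.

(** The primitive is the integral from -1 of f extended by 0; its limits follow from continuity of
    the integral in its upper bound. *)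
Lemma integrable_cumulative f : mu.-integrable I (EFin \o f) ->
  exists N, [/\ primitive f N, N x @[x --> (-1)^'+] --> (0 : R) &
    N x @[x --> 1^'-] --> \int[mu]_(x in I) f x].
Proof.
move=> intf; pose k := f \_ I.
have N11 : -1 < 1 :> R by rewrite gtrN.
have mI : measurable I by exact: measurable_itv.
have intk : mu.-integrable setT (EFin \o k).
  by rewrite -restrict_EFin; apply/(integrable_mkcond _ _).1.
have intkS a b : mu.-integrable `[a, b] (EFin \o k) by apply: integrableS intk.
have sub : I `<=` `[-1, 1] by exact: subset_itv_oo_cc.
have E1 : \int[mu]_(x in `[-1, 1]) k x = \int[mu]_(x in I) f x.
  by rewrite /k -Rintegral_mkcondr setIidr.
exists (fun x => parameterized_integral mu (-1) x k); split.
- move=> a b a1 ab b1; split; first by apply: integrableS intf => //; exact: sub_itv_I.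
  rewrite /parameterized_integral (Rintegral_itv_split (ltW a1) ab)//.
  rewrite addrC addKr /k -Rintegral_mkcondr setIidl//; exact: sub_itv_I.
- apply: cvg_at_right_filter.
  exact: (parameterized_integral_cvg_left N11 (intkS (-1) 1)).
- have := parameterized_integral_cvg_at_left N11 (intkS (-1) 1).
  by rewrite {2}/parameterized_integral E1.
Qed.

(** Otherwise (1 - x^2) q > e throughout, so q >= e / K on [u, v], which contradicts the bound on
    the integral. *)
Lemma exists_weighted_le q u v K e : mu.-integrable `[u, v] (EFin \o q) ->
  (forall x, 0 <= q x) -> u < v -> 0 < K -> 
  (forall x, u <= x -> x <= v -> 1 - x ^+ 2 <= K) -> 0 < e ->
  \int[mu]_(x in `[u, v]) q x < e / K * (v - u) ->
  exists x, [/\ u <= x, x <= v & (1 - x ^+ 2) * q x <= e].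
Proof.
move=> intq q0 uv K0 wK e0; apply: contraPP => /forallNP H.
apply/negP; rewrite -leNgt.
have -> : e / K * (v - u) = \int[mu]_(x in `[u, v]) (cst (e / K) x).
  rewrite Rintegral_cst//; congr (_ * _).
  by have := lebesgue_measure_itv (`[u, v]%R); rewrite /= lte_fin uv => ->.
apply: le_Rintegral => //.
  apply: continuous_compact_integrable; first exact: segment_compact.
  by apply: continuous_subspaceT => x; exact: cvg_cst.
move=> x; rewrite /= in_itv/= => /andP[ux xv].
rewrite ler_pdivrMr// leNgt; apply/negP => qe.
have := H x; apply; split => //.
by rewrite mulrC (le_trans _ (ltW qe))// ler_wpM2l// wK.
Qed.

(** On [1 - s, 1 - s/2] the weight is at most 2 s, so the threshold of [exists_weighted_le] is e /
    (2 s) times s / 2, that is e / 4 for every s. This is the divergence of the integral of 1 / (1 -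
    x^2) on a dyadic scale. The integral of q there falls below e / 4 because both end values of the
    cumulative integral are within e / 8 of its limit. *)
Lemma endpoint_right q (P : R -> Prop) e : mu.-integrable I (EFin \o q) ->
  (forall x, 0 <= q x) -> 0 < e -> (\forall x \near 1^'-, P x) ->
  exists x, [/\ -1 < x, x < 1, P x & (1 - x ^+ 2) * q x <= e].
Proof.
move=> intq q0 e0 nP.
have [N [qN _ N1]] := integrable_cumulative intq.
have e8 : 0 < e / 8 by rewrite divr_gt0.
have nN : \forall x \near (1:R)^'-, `|\int[mu]_(x in I) q x - N x| < e / 8.
  by move/cvgrPdist_lt : N1; exact.
have [d /= d0 Hd] := filterI nP nN.
(* The bound d / 2 keeps the interval where [Hd] applies, and 1 / 2 keeps it inside (-1,1). *)
pose s := Num.min (d / 2) (1 / 2).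
have s0 : 0 < s by rewrite lt_min; apply/andP; split; lra.
have sd : s <= d / 2 by rewrite ge_min lexx.
have s2 : s <= 1 / 2 by rewrite ge_min lexx orbT.
have Hx x : 1 - s <= x -> x < 1 -> P x /\ `|\int[mu]_(x in I) q x - N x| < e / 8.
  move=> sx x1; apply: Hd => //=; rewrite ger0_norm; lra.
have u1 : 1 - s <= 1 - s by []. have v1 : 1 - s <= 1 - s / 2 by lra.
have [_ Nu] := Hx (1 - s) u1 ltac:(lra).
have [_ Nv] := Hx (1 - s / 2) v1 ltac:(lra).
have [intuv E] := qN (1 - s) (1 - s / 2) ltac:(lra) v1 ltac:(lra).
have := @exists_weighted_le q (1 - s) (1 - s / 2) (2 * s) e intuv q0 ltac:(lra) ltac:(lra) _ e0 _.
case.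
- by move=> x ux xv; nra.
- rewrite -E.
  have -> : e / (2 * s) * (1 - s / 2 - (1 - s)) = e / 4 by field; lra.
  by move: Nu Nv; rewrite !ltr_norml => /andP[? ?] /andP[? ?]; lra.
move=> x [ux xv wq]; exists x; split => //; [lra|lra|].
by apply: (Hx x ux _).1; lra.
Qed.

(** Mirror image of [endpoint_right] on [-1 + s/2, -1 + s], where the cumulative integral tends to
    0. *)
Lemma endpoint_left q (P : R -> Prop) e : mu.-integrable I (EFin \o q) ->
  (forall x, 0 <= q x) -> 0 < e -> (\forall x \near (-1)^'+, P x) ->
  exists x, [/\ -1 < x, x < 1, P x & (1 - x ^+ 2) * q x <= e].
Proof.
move=> intq q0 e0 nP.
have [N [qN N1 _]] := integrable_cumulative intq.
have e8 : 0 < e / 8 by rewrite divr_gt0.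
have nN : \forall x \near (-1:R)^'+, `|0 - N x| < e / 8.
  by move/cvgrPdist_lt : N1; exact.
have [d /= d0 Hd] := filterI nP nN.
pose s := Num.min (d / 2) (1 / 2).
have s0 : 0 < s by rewrite lt_min; apply/andP; split; lra.
have sd : s <= d / 2 by rewrite ge_min lexx.
have s2 : s <= 1 / 2 by rewrite ge_min lexx orbT.
have Hx x : x <= -1 + s -> -1 < x -> P x /\ `|0 - N x| < e / 8.
  move=> sx x1; apply: Hd => //=; rewrite ltr0_norm; lra.
have u1 : -1 + s <= -1 + s by []. have v1 : -1 + s / 2 <= -1 + s by lra.
have [_ Nu] := Hx (-1 + s) u1 ltac:(lra).
have [_ Nv] := Hx (-1 + s / 2) v1 ltac:(lra).
have [intuv E] := qN (-1 + s / 2) (-1 + s) ltac:(lra) v1 ltac:(lra).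
have := @exists_weighted_le q (-1 + s / 2) (-1 + s) (2 * s) e intuv q0
  ltac:(lra) ltac:(lra) _ e0 _.
case.
- by move=> x ux xv; nra.
- rewrite -E.
  have -> : e / (2 * s) * (-1 + s - (-1 + s / 2)) = e / 4 by field; lra.
  by move: Nu Nv; rewrite !ltr_norml => /andP[? ?] /andP[? ?]; lra.
move=> x [ux xv wq]; exists x; split => //; [lra|lra|].
by apply: (Hx x xv _).1; lra.
Qed.

End endpoints.

(** * The integrand as a sum of squares up to an exact derivative *)

Section energy_density.
Context {R : realType}.
Notation mu := (@lebesgue_measure R).
Notation I := (@Iopen R).
Implicit Types (f g h p q F G U : R -> R) (x a b e m : R).

Lemma primitive_id : primitive (fun=> 1) (@id R).
Proof.
by apply: primitive_derive => x; exact: cvg_cst.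
Qed.

Lemma primitive_cst c : primitive (fun=> 0) (fun=> c : R).
Proof.
by apply: primitive_derive => x; exact: cvg_cst.
Qed.

Lemma primitive_weight : primitive (fun z => - 2 * z) (fun z : R => 1 - z ^+ 2).
Proof.
have H := primitiveD (primitive_cst 1) (primitiveZ (-1) (primitiveM primitive_id primitive_id)).
by apply: eq_primitive H => z; rewrite /=; ring.
Qed.

Section storage.
Context (p U F G : R -> R) (m : R).

(** The integrand of Q0 - (3/56) J0 for the representatives F, U, p of Psi and its two
    derivatives. *)
Definition lagrangian z := 1 / 8 * ((1 - z ^+ 2) ^+ 3 * p z ^+ 2) +
  3 / 4 * ((3 * z ^+ 2 - 1) * F z ^+ 2) - 3 / 56 * ((1 - z ^+ 2) * U z ^+ 2).

(** With w = 1 - z^2, the first three terms come from completing the square in w^3 p^2. The two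
    terms with 25/14 = 4 (1/2 - 3/56) come from the identity for w U^2, and the next one from a
    third of the cross term in -(9/8) w F^2. In the last, 585/296 = 9/8 + (37/56) (42/37)^2 with
    37/56 = 25/14 - 9/8, and 63/200 = (25/14) (21/50)^2. *)
Definition storage z :=
  3 / 4 * ((1 - z ^+ 2) ^+ 2 * (U z * F z)) + 3 / 4 * (z * ((1 - z ^+ 2) * F z ^+ 2))
  - 1 / 4 * (z * ((1 - z ^+ 2) ^+ 2 * U z ^+ 2))
  + 25 / 14 * ((1 - z ^+ 2) * (G z * (F z - m))) + 25 / 14 * (z * G z ^+ 2)
  + 3 / 4 * m * ((1 - z ^+ 2) * G z)
  + m ^+ 2 * (585 / 296 * (z - z ^+ 3 / 3) + 63 / 200 * z).

(* The constants 42/37 and 21/50 complete the squares in m w (F - m) and m z G;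
   the last line of storage integrates the m^2 terms this produces. *)
Definition squares z :=
  1 / 8 * (1 - z ^+ 2) * ((1 - z ^+ 2) * p z - 2 * z * U z + 3 * F z) ^+ 2
  + 25 / 56 * (1 - z ^+ 2) * (U z + 2 * G z) ^+ 2
  + 37 / 56 * (1 - z ^+ 2) * (F z - m - 42 / 37 * m) ^+ 2
  + 25 / 14 * (z * G z - 21 / 50 * m) ^+ 2.

Context (pU : primitive p U) (UF : primitive U F)
  (FG : primitive (fun z => F z - m) G).

Lemma primitive_storage : primitive (fun z => squares z - lagrangian z) storage.
Proof.
have pz := primitive_id; have pw := primitive_weight.
have Uf : primitive U (fun z => F z - m).
  by apply: eq_primitive (primitiveD UF (primitive_cst (- m))) => z; rewrite ?addr0.
(* The product rule is applied to each term of [storage], the m^2 polynomial being split in two; the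
   sum is then matched by algebra. *)
have H1 := primitiveZ (3 / 4) (primitiveM (primitiveM pw pw) (primitiveM pU UF)).
have H2 := primitiveZ (3 / 4) (primitiveM pz (primitiveM pw (primitiveM UF UF))).
have H3 := primitiveZ (- (1 / 4))
  (primitiveM pz (primitiveM (primitiveM pw pw) (primitiveM pU pU))).
have H4 := primitiveZ (25 / 14) (primitiveM pw (primitiveM FG Uf)).
have H5 := primitiveZ (25 / 14) (primitiveM pz (primitiveM FG FG)).
have H6 := primitiveZ (3 / 4 * m) (primitiveM pw FG).
have H7 := primitiveZ (m ^+ 2 * (585 / 296 + 63 / 200)) pz.
have H8 := primitiveZ (- (m ^+ 2 * (585 / 296) / 3)) (primitiveM pz (primitiveM pz pz)).
have H := primitiveD (primitiveD (primitiveD H1 H2) (primitiveD H3 H4))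
  (primitiveD (primitiveD H5 H6) (primitiveD H7 H8)).
by apply: eq_primitive H => z; rewrite /= ?/squares ?/lagrangian ?/storage; field.
Qed.

Lemma squares_ge0 z : I z -> 0 <= squares z.
Proof.
rewrite /Iopen /= in_itv/= => /andP[z1 z2].
have w0 : 0 <= 1 - z ^+ 2 by nra.
have sq (k X : R) : 0 <= k -> 0 <= k * X ^+ 2.
  by move=> k0; apply: mulr_ge0 => //; exact: sqr_ge0.
have c0 (c : R) : 0 <= c -> 0 <= c * (1 - z ^+ 2) by move=> c0; exact: mulr_ge0.
rewrite /squares !addr_ge0//; apply: sq; rewrite ?divr_ge0//; apply: c0; exact: divr_ge0.
Qed.

(** The right side minus the left side is the integral of [squares], which is nonnegative. *)
Lemma lagrangian_ge a b N : primitive lagrangian N -> -1 < a -> a <= b -> b < 1 ->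
  storage a - storage b <= N b - N a.
Proof.
move=> LN a1 ab b1.
have [intL EL] := LN a b a1 ab b1; have [intS ES] := primitive_storage a1 ab b1.
rewrite -subr_ge0 opprB.
have -> : N b - N a + (storage b - storage a) = \int[mu]_(x in `[a, b]) squares x.
  rewrite EL ES -RintegralD//; apply: eq_Rintegral => x _.
  by rewrite addrC subrK.
by apply: Rintegral_ge0 => x /(sub_itv_I a1 b1); exact: squares_ge0.
Qed.

(** Once w G (F - m) is split in two, each monomial is at most e in absolute value, mixed ones by 2
    |X Y| <= X^2 + Y^2. The absolute values of the coefficients add up to 5/2 + 75/14 < 9. *)
Lemma storage_le z e : I z -> (1 - z ^+ 2) * (F z ^+ 2 + (1 - z ^+ 2) * U z ^+ 2) <= e ->
  (1 - z ^+ 2) * m ^+ 2 <= e -> G z ^+ 2 <= e ->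
  `|storage z - m ^+ 2 * (585 / 296 * (z - z ^+ 3 / 3) + 63 / 200 * z)| <= 9 * e.
Proof.
rewrite /Iopen /= in_itv/= => /andP[z1 z2].
rewrite /storage addrK.
set w := 1 - z ^+ 2 => wq wm G2.
have w0 : 0 <= w by rewrite /w; nra.
have w1 : w <= 1 by rewrite /w lerBlDr lerDl sqr_ge0.
have wF : w * F z ^+ 2 <= e.
  apply: le_trans wq; rewrite mulrDr lerDl mulr_ge0// mulr_ge0//; exact: sqr_ge0.
have wU : w ^+ 2 * U z ^+ 2 <= e.
  apply: le_trans wq; rewrite mulrDr expr2 -mulrA lerDr mulr_ge0//; exact: sqr_ge0.
have ww X : 0 <= X -> w ^+ 2 * X <= w * X.
  by move=> X0; rewrite expr2 -mulrA ler_piMl// mulr_ge0.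
have wF2 := le_trans (ww _ (sqr_ge0 (F z))) wF.
have wm2 := le_trans (ww _ (sqr_ge0 m)) wm.
have z1n : `|z| <= 1 by rewrite ler_norml !ltW.
have zX X : 0 <= X -> X <= e -> `|z * X| <= e.
  by move=> X0 Xe; rewrite normrM (ger0_norm X0) (le_trans _ Xe)// ler_piMl.
have T1 : `|w ^+ 2 * (U z * F z)| <= e.
  rewrite ler_norml; apply/andP; split.
    have := sqr_ge0 (w * U z + w * F z); nra.
  have := sqr_ge0 (w * U z - w * F z); nra.
have T2 : `|z * (w * F z ^+ 2)| <= e by apply: zX => //; rewrite mulr_ge0 ?sqr_ge0.
have T3 : `|z * (w ^+ 2 * U z ^+ 2)| <= e by apply: zX => //; rewrite mulr_ge0 ?sqr_ge0.
have T5 : `|z * G z ^+ 2| <= e by apply: zX => //; exact: sqr_ge0.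
have T6 : `|m * (w * G z)| <= e.
  rewrite ler_norml; apply/andP; split.
    have := sqr_ge0 (w * m + G z); nra.
  have := sqr_ge0 (w * m - G z); nra.
have T7 : `|w * (G z * F z)| <= e.
  rewrite ler_norml; apply/andP; split.
    have := sqr_ge0 (w * F z + G z); nra.
  have := sqr_ge0 (w * F z - G z); nra.
move: T1 T2 T3 T5 T6 T7; rewrite !ler_norml.
have -> : w * (G z * (F z - m)) = w * (G z * F z) - m * (w * G z) by ring.
rewrite -(mulrA (3/4) m).
move: (w ^+ 2 * (U z * F z)) (z * (w * F z ^+ 2)) (z * (w ^+ 2 * U z ^+ 2)) => t1 t2 t3.
move: (z * G z ^+ 2) (m * (w * G z)) (w * (G z * F z)) => t5 t6 t7.
move=> /andP[? ?] /andP[? ?] /andP[? ?] /andP[? ?] /andP[? ?] /andP[? ?].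
by apply/andP; split; lra.
Qed.

End storage.
End energy_density.

(** * The inequality for regular representatives, by passing to the endpoints *)

Section inequality.
Context {R : realType}.
Notation mu := (@lebesgue_measure R).
Notation I := (@Iopen R).
Implicit Types (f g h p q F G U : R -> R) (x a b e m : R).

Lemma ae_sub (P Q : R -> Prop) : (forall x, P x -> Q x) ->
  {ae mu, forall x, P x} -> {ae mu, forall x, Q x}.
Proof. by move=> PQ; apply: filterS; first exact: (ae_filter_ringOfSetsType mu). Qed.

Lemma primitive_measurable f F : primitive f F -> measurable_fun I F.
Proof.
move=> fF; apply: open_continuous_measurable_fun; first exact: interval_open.
move=> x; rewrite inE /Iopen /= in_itv/= => /andP[x1 x2].
have ab : (x - 1) / 2 < (x + 1) / 2 by lra.
have a1 : -1 < (x - 1) / 2 by lra.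
have b1 : (x + 1) / 2 < 1 by lra.
have /(continuous_within_itvP _ ab)[cF _ _] := primitive_continuous fF a1 (ltW ab) b1.
by apply: cF; rewrite in_itv/=; apply/andP; split; lra.
Qed.

Lemma ae_integrable f g : measurable_fun I g -> {ae mu, forall x, I x -> f x = g x} ->
  mu.-integrable I (EFin \o f) -> mu.-integrable I (EFin \o g).
Proof.
move=> mg fg intf; move/integrableP: (intf) => [mf lf].
have mI : measurable I by exact: measurable_itv.
apply/integrableP; split; first exact/measurable_EFinP.
have <- : (\int[mu]_(x in I) (abse \o (EFin \o f)) x =
          \int[mu]_(x in I) (abse \o (EFin \o g)) x)%E.
  apply: ae_eq_integral => //.
  - exact: measurableT_comp.
  - by apply: measurableT_comp => //; exact/measurable_EFinP.
  - by apply: ae_sub fg => x + Ix => /(_ Ix) /= ->.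
exact: lf.
Qed.

Lemma ae_Rintegral f g : measurable_fun I f -> measurable_fun I g ->
  {ae mu, forall x, I x -> f x = g x} ->
  \int[mu]_(x in I) f x = \int[mu]_(x in I) g x.
Proof.
move=> mf mg fg; congr fine; apply: ae_eq_integral.
- exact: measurable_itv.
- exact/measurable_EFinP.
- exact/measurable_EFinP.
- by apply: ae_sub fg => x + Ix => /(_ Ix) /= ->.
Qed.

(** The cubic z - z^3/3 lies between -2/3 and 2/3 on [-1, 1], as the factorizations of z^3 - 3 z + 2
    and 2 + 3 z - z^3 show. *)
Lemma drift_bounds (z : R) : -1 <= z -> z <= 1 ->
  - (195 / 148 + 63 / 200) <= 585 / 296 * (z - z ^+ 3 / 3) + 63 / 200 * z <=
    195 / 148 + 63 / 200.
Proof.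
move=> z1 z2.
have h1 : 0 <= (1 - z) ^+ 2 * (z + 2) by rewrite mulr_ge0 ?sqr_ge0//; lra.
have h2 : 0 <= (1 + z) ^+ 2 * (2 - z) by rewrite mulr_ge0 ?sqr_ge0//; lra.
have E1 : (1 - z) ^+ 2 * (z + 2) = z ^+ 3 - 3 * z + 2 by ring.
have E2 : (1 + z) ^+ 2 * (2 - z) = 2 + 3 * z - z ^+ 3 by ring.
by rewrite E1 in h1; rewrite E2 in h2; apply/andP; split; lra.
Qed.

Lemma energy_inequality p U F : primitive p U -> primitive U F ->
  mu.-integrable I (EFin \o (fun z => F z ^+ 2)) ->
  mu.-integrable I (EFin \o (fun z => (1 - z ^+ 2) * U z ^+ 2)) ->
  mu.-integrable I (EFin \o (fun z => (1 - z ^+ 2) ^+ 3 * p z ^+ 2)) ->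
  3 / 56 * (J0 U + M0 F ^+ 2) <= Q0 F p + M0 F ^+ 2.
Proof.
move=> pU UF intF intU intp.
have mI : measurable I by exact: measurable_itv.
have N11 : -1 < 1 :> R by rewrite gtrN.
have E2 c : \int[mu]_(x in I) (cst c x) = c * 2.
  rewrite Rintegral_cst//; congr (_ * _).
  have := lebesgue_measure_itv (`]-1, 1[%R : interval R); rewrite /= lte_fin N11 => ->.
  by rewrite /= opprK.
have int1 c : mu.-integrable I (EFin \o cst c).
  have i1 : mu.-integrable `[-1, 1] (EFin \o cst c).
    apply: continuous_compact_integrable; first exact: segment_compact.
    by apply: continuous_subspaceT => x; exact: cvg_cst.
  by apply: integrableS i1 => //; exact: subset_itv_oo_cc.
have mF := primitive_measurable UF.
(* Dominated through |F| <= 1 + F^2. *)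
have intF1 : mu.-integrable I (EFin \o F).
  apply: (le_integrable _ _ _ (integrableD _ (int1 1) intF)) => //.
    exact/measurable_EFinP.
  move=> x _; rewrite /= lee_fin [leRHS]ger0_norm ?addr_ge0 ?sqr_ge0//.
  by rewrite ler_norml; apply/andP; split; nra.
have intF3 : mu.-integrable I (EFin \o (fun z => (3 * z ^+ 2 - 1) * F z ^+ 2)).
  apply: (le_integrable _ _ _ (integrableZl _ 2 intF)) => //.
    apply/measurable_EFinP/measurable_funM; last exact: measurable_funX.
    apply: measurable_funB => //; apply: measurable_funM => //.
  move=> x; rewrite /Iopen /= in_itv/= => /andP[x1 x2].
  have F0 := sqr_ge0 (F x).
  have H2 : 0 <= 2 * F x ^+ 2 by rewrite mulr_ge0.
  change (`|(3 * x ^+ 2 - 1) * F x ^+ 2|%:E <= `|2 * F x ^+ 2|%:E)%E.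
  rewrite lee_fin (ger0_norm H2) normrM (ger0_norm F0) ler_wpM2r//.
  by rewrite ler_norml; apply/andP; split; nra.
have intL : mu.-integrable I (EFin \o lagrangian p U F).
  apply: (integrableB _ (integrableD _ (integrableZl _ (1 / 8) intp)
    (integrableZl _ (3 / 4) intF3)) (integrableZl _ (3 / 56) intU)) => //.
have EL : \int[mu]_(z in I) lagrangian p U F z =
    Q0 F p - 3 / 56 * J0 U.
  have Z k f : mu.-integrable I (EFin \o f) ->
      mu.-integrable I (EFin \o (fun z => k * f z)).
    by move=> H; exact: (integrableZl _ k H).
  have RZ k f : mu.-integrable I (EFin \o f) ->
      \int[mu]_(z in I) (k * f z) = k * \int[mu]_(z in I) f z.
    by move=> H; apply: RintegralZl.
  rewrite /lagrangian RintegralB; [|exact: mI| |exact: Z].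
    rewrite RintegralD; [|exact: mI|exact: Z|exact: Z].
    by rewrite (RZ _ _ intp) (RZ _ _ intF3) (RZ _ _ intU).
  by apply: (integrableD _ (Z (1 / 8) _ intp) (Z (3 / 4) _ intF3)).
set m := M0 F / 2.
have intFm : mu.-integrable I (EFin \o (fun z => F z - m)).
  exact: (integrableB _ intF1 (int1 m)).
have EFm : \int[mu]_(z in I) (F z - m) = 0.
  rewrite RintegralB//; last exact: int1.
  by rewrite E2 /m divfK// subrr.
(* The absolute value changes nothing on (-1,1) but gives nonnegativity on the whole line, as the
   endpoint lemmas require. *)
have intq : mu.-integrable I (EFin \o (fun z => `|F z ^+ 2 + (1 - z ^+ 2) * U z ^+ 2|)).
  apply: (integrable_norm (integrableD _ intF intU)) => //.
have [N [LN N0 N1]] := integrable_cumulative intL.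
have [G [FG G0 G1]] := integrable_cumulative intFm.
rewrite EL in N1; rewrite EFm in G1.
(* The error 20 e is 9 e from [storage] and e from N at each of the two endpoints. *)
suff H e : 0 < e -> - (m ^+ 2 * (195 / 74 + 63 / 100)) <= Q0 F p - 3 / 56 * J0 U + 20 * e.
  have : - (m ^+ 2 * (195 / 74 + 63 / 100)) <= Q0 F p - 3 / 56 * J0 U.
    apply/ler_addgt0Pr => e e0.
    have -> : e = 20 * (e / 20) by field.
    by apply: H; rewrite divr_gt0.
  have : 0 <= m ^+ 2 by exact: sqr_ge0.
  have -> : M0 F ^+ 2 = 4 * m ^+ 2 by rewrite /m; field.
  by lra.
move=> e0.
have small (t : R) : 0 < t -> t <= 1 -> forall X : R, `|0 - X| < t -> X ^+ 2 <= t.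
  move=> t0 t1 X; rewrite sub0r normrN => Xt.
  by move: Xt; rewrite ltr_norml => /andP[? ?]; nra.
pose t : R := Num.min 1 e.
have t0 : 0 < t by rewrite lt_min ltr01.
have t1 : t <= 1 by rewrite ge_min lexx.
have te : t <= e by rewrite ge_min lexx orbT.
(* Within d of an endpoint w is at most 2 d, so w m^2 <= e; the added 1 covers m = 0. *)
pose d := e / (2 * (m ^+ 2 + 1)).
have m1 : 0 < m ^+ 2 + 1 by rewrite ltr_wpDl ?sqr_ge0.
have d0 : 0 < d by rewrite divr_gt0// mulr_gt0.
have dm : 2 * d * m ^+ 2 <= e.
  have -> : e = 2 * d * (m ^+ 2 + 1) by rewrite /d; field; rewrite gt_eqF.
  by rewrite ler_wpM2l ?lerDl// mulr_ge0// ltW.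
have [b [b1 b2 [b0 Gb Nb bd] qb]] : exists x, [/\ -1 < x, x < 1,
    [/\ 0 < x, `|0 - G x| < t, `|(Q0 F p - 3 / 56 * J0 U) - N x| < e & 1 - d < x] &
    (1 - x ^+ 2) * `|F x ^+ 2 + (1 - x ^+ 2) * U x ^+ 2| <= e].
  apply: endpoint_right => //.
  near=> x; split.
  - by near: x; apply: nbhs_left_gt; exact: ltr01.
  - by near: x; move/cvgrPdist_lt : G1; exact.
  - by near: x; move/cvgrPdist_lt : N1; exact.
  - by near: x; apply: nbhs_left_gt; rewrite gtrBl.
have [a [a1 a2 [a0 Ga Na ad] qa]] : exists x, [/\ -1 < x, x < 1,
    [/\ x < 0, `|0 - G x| < t, `|0 - N x| < e & x < -1 + d] &
    (1 - x ^+ 2) * `|F x ^+ 2 + (1 - x ^+ 2) * U x ^+ 2| <= e].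
  apply: endpoint_left => //.
  near=> x; split.
  - by near: x; apply: nbhs_right_lt; rewrite oppr_lt0.
  - by near: x; move/cvgrPdist_lt : G0; exact.
  - by near: x; move/cvgrPdist_lt : N0; exact.
  - by near: x; apply: nbhs_right_lt; rewrite ltrDl.
have Ib : I b by rewrite /Iopen /= in_itv/= b1 b2.
have Ia : I a by rewrite /Iopen /= in_itv/= a1 a2.
have qnorm x : I x -> (1 - x ^+ 2) * (F x ^+ 2 + (1 - x ^+ 2) * U x ^+ 2) =
    (1 - x ^+ 2) * `|F x ^+ 2 + (1 - x ^+ 2) * U x ^+ 2|.
  rewrite /Iopen /= in_itv/= => /andP[x1 x2].
  by rewrite ger0_norm// addr_ge0 ?sqr_ge0// mulr_ge0 ?sqr_ge0//; clear - x1 x2; nra.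
have wb : (1 - b ^+ 2) * m ^+ 2 <= e.
  apply: le_trans dm; rewrite ler_wpM2r ?sqr_ge0//; clear - b1 b2 bd; nra.
have wa : (1 - a ^+ 2) * m ^+ 2 <= e.
  apply: le_trans dm; rewrite ler_wpM2r ?sqr_ge0//; clear - a1 a2 ad; nra.
have Sb := @storage_le _ U F G m b e Ib.
rewrite qnorm// in Sb; have {}Sb := Sb qb wb (le_trans (small _ t0 t1 _ Gb) te).
have Sa := @storage_le _ U F G m a e Ia.
rewrite qnorm// in Sa; have {}Sa := Sa qa wa (le_trans (small _ t0 t1 _ Ga) te).
have ab : a <= b by exact: ltW (lt_trans a0 b0).
have H := lagrangian_ge pU UF FG LN a1 ab b2.
have /andP[_ Tb] : - (195 / 148 + 63 / 200) <= 585 / 296 * (b - b ^+ 3 / 3) + 63 / 200 * b <=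
    195 / 148 + 63 / 200 by apply: drift_bounds; exact: ltW.
have /andP[Ta _] : - (195 / 148 + 63 / 200) <= 585 / 296 * (a - a ^+ 3 / 3) + 63 / 200 * a <=
    195 / 148 + 63 / 200 by apply: drift_bounds; exact: ltW.
have m0 := sqr_ge0 m.
have Tbm := ler_wpM2l m0 Tb; have Tam := ler_wpM2l m0 Ta.
move: Sb Sa Nb Na; rewrite !ler_norml !ltr_norml.
move=> /andP[Sb1 Sb2] /andP[Sa1 Sa2] /andP[Nb1 Nb2] /andP[Na1 Na2].
clear - Sb1 Sa1 Sa2 Sb2 Nb1 Nb2 Na1 Na2 Tbm Tam H.
by lra.
Unshelve. all: end_near. Qed.

Lemma in_L2_integrable f : in_L2 f -> mu.-integrable I (EFin \o (fun x => f x ^+ 2)).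
Proof.
move=> /Lfun2_integrable_sqr; rewrite /in_L2 => intf.
have mI : measurable I by exact: measurable_itv.
have : mu.-integrable I (EFin \o (fun x => (f \_ I) x ^+ 2)) by exact: integrableS intf.
by apply: eq_integrable => // x xI; rewrite /= patchE xI.
Qed.

Lemma powR_half_sqr (w : R) (n : nat) : 0 <= w -> (w `^ (n%:R / 2)) ^+ 2 = w ^+ n.
Proof.
move=> w0; rewrite -powR_mulrn ?powR_ge0// -powRrM divfK ?pnatr_eq0//.
exact: powR_mulrn.
Qed.

End inequality.

(** * Reduction of the distributional statement to regular representatives *)

Theorem lemma4p1 (R : realType) (Psi Psi_z Psi_zz : R -> R)
  (hPsi : in_L2 Psi)
  (hPsi_z : distr_derive 1 Psi Psi_z)
  (hPsi_zz : distr_derive 2 Psi Psi_zz)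
  (hw1 : in_L2 (fun z => (1 - z ^+ 2) `^ (1 / 2) * Psi_z z))
  (hw2 : in_L2 (fun z => (1 - z ^+ 2) `^ (3 / 2) * Psi_zz z)) :
  Q0 Psi Psi_zz + M0 Psi ^+ 2 >= 3 / 56 * (J0 Psi_z + M0 Psi ^+ 2).
Proof.
pose mu := @lebesgue_measure R.
have mI : measurable (@Iopen R) by exact: measurable_itv.
have [lPsi lPsi_z D1] := hPsi_z; have [_ lPsi_zz D2] := hPsi_zz.
have mPsi : measurable_fun (@Iopen R) Psi by case: lPsi.
have mPsi_z : measurable_fun (@Iopen R) Psi_z by case: lPsi_z.
have [U pU PzU] : exists2 U, primitive Psi_zz U &
    {ae mu, forall x, Iopen x -> Psi_z x = U x}.
  (* [Psi_zz] is the weak derivative of [Psi_z]: the second-order relation for phi and the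
     first-order one for phi' both involve the integral of Psi phi''. *)
  apply: weak_primitive; [exact: locally_integrable_itv|exact: locally_integrable_itv|].
  move=> phi r r0 r1 supp sphi.
  pose s := (r + 1) / 2.
  have rs : r < s by rewrite /s; lra.
  have s1 : s < 1 by rewrite /s; lra.
  have supp' := supported_derive1 rs supp sphi.
  rewrite (D2 _ (smooth_test_function r1 sphi supp)).
  rewrite (D1 _ (smooth_test_function s1 (smooth_derive1 sphi) supp')).
  by rewrite sqrrN !expr1n !mul1r expr1 mulN1r opprK.
have [F UF' PF] : exists2 F, primitive Psi_z F &
    {ae mu, forall x, Iopen x -> Psi x = F x}.
  apply: weak_primitive; [exact: locally_integrable_itv|exact: locally_integrable_itv|].
  move=> phi r r0 r1 supp sphi.
  rewrite (D1 _ (smooth_test_function r1 sphi supp)).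
  by rewrite expr1 mulN1r.
(* [Psi_z] may be replaced by [U] under the integral, since they agree almost everywhere. *)
have UF : primitive U F.
  move=> a b a1 ab b1; have [intz E] := UF' a b a1 ab b1.
  split.
    apply: continuous_compact_integrable; first exact: segment_compact.
    exact: primitive_continuous pU a1 ab b1.
  rewrite E; congr fine; apply: ae_eq_integral => //.
  - by case/integrableP: intz.
  - apply/measurable_EFinP; apply: measurable_funS (primitive_measurable pU) => //.
    exact: sub_itv_I.
  - by apply: ae_sub PzU => x + xab => /(_ (sub_itv_I a1 b1 xab)) /= ->.
have mF := primitive_measurable UF; have mU := primitive_measurable pU.
have mw : measurable_fun (@Iopen R) (fun z : R => 1 - z ^+ 2).
  by apply: measurable_funB => //; exact: measurable_funX.
have w0 z : Iopen z -> 0 <= 1 - z ^+ 2 :> R.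
  rewrite /Iopen /= in_itv/= => /andP[z1 z2]; nra.
have EM : M0 Psi = M0 F by exact: ae_Rintegral.
have EJ : J0 Psi_z = J0 U.
  apply: ae_Rintegral; [by apply: measurable_funM => //; exact: measurable_funX..|].
  by apply: ae_sub PzU => x + Ix => /(_ Ix) ->.
have EQ : Q0 Psi Psi_zz = Q0 F Psi_zz.
  rewrite /Q0; congr (_ + _ * _).
  have m3 : measurable_fun (@Iopen R) (fun z : R => 3 * z ^+ 2 - 1).
    apply: measurable_funB => //; apply: measurable_funM => //.
  apply: ae_Rintegral; [by apply: measurable_funM => //; exact: measurable_funX..|].
  by apply: ae_sub PF => x + Ix => /(_ Ix) ->.
rewrite EM EJ EQ.
apply: (energy_inequality pU UF).
- apply: ae_integrable (in_L2_integrable hPsi); first exact: measurable_funX.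
  by apply: ae_sub PF => x + Ix => /(_ Ix) ->.
- apply: ae_integrable (in_L2_integrable hw1).
    by apply: measurable_funM => //; exact: measurable_funX.
  apply: ae_sub PzU => x + Ix => /(_ Ix) <-.
  by rewrite exprMn (powR_half_sqr 1) ?w0// expr1.
- have := in_L2_integrable hw2; apply: eq_integrable => // x /set_mem Ix /=.
  by rewrite exprMn (powR_half_sqr 3) ?w0.
Qed.
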